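(* Let $C$ be a non-trivial two-coloring of $\mathbb{Z}^d$ with min-width $k$, and let $s = s(C)$. Then \[ s \ge \frac{1}{e^2}\, d^{1/k}. \]
   Context: A two-coloring $C$ of $\mathbb{Z}^d$ assigns to each lattice point one of two colors, red or blue. $C$ is non-trivial if the origin is red and, for each $i\in\{1,\dots,d\}$, there is at least one blue point on the $i$-th coordinate axis (a point all of whose coordinates other than the $i$-th are zero). The min-width of a non-trivial coloring is the minimum integer $k$ such that, for every one of the $d$ axes, there is a blue point on that axis at distance at most $k$ from the origin. Two points of $\mathbb{Z}^d$ are neighbors if they differ by $\pm 1$ in exactly one coordinate. The sensitivity $s(C,x)$ is the number of neighbors of $x$ colored differently from $x$, and $s(C)=\max_{x\in\mathbb{Z}^d} s(C,x)$. *)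

(* Defs.v *)
From mathcomp Require Import all_boot all_order all_algebra.
From mathcomp Require Import finmap.
From mathcomp Require Import boolp classical_sets cardinality.

Set Implicit Arguments.
Unset Strict Implicit.
Unset Printing Implicit Defensive.

Import Order.TTheory GRing.Theory Num.Theory.
Local Open Scope ring_scope.
Local Open Scope classical_set_scope.

Definition point (d : nat) := {ffun 'I_d -> int}.

Variant color := Red | Blue.

Definition coloring (d : nat) := point d -> color.

Definition on_axis d (i : 'I_d) (x : point d) : Prop :=
  forall j : 'I_d, j != i -> x j = 0.

Definition nontrivial d (C : coloring d) : Prop :=
  C 0 = Red /\ forall i : 'I_d, exists2 x, on_axis i x & C x = Blue.

(* A point x of the i-th axis is at distance |x_i| from the origin. *)
Definition blue_within d (C : coloring d) (k : nat) : Prop :=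
  forall i : 'I_d, exists x, [/\ on_axis i x, C x = Blue & (`|x i| <= k)%N].

Definition is_min_width d (C : coloring d) (k : nat) : Prop :=
  blue_within C k /\ forall m : nat, blue_within C m -> (k <= m)%N.

Definition neighbor d (x y : point d) : Prop :=
  exists2 i : 'I_d, y i = x i + 1 \/ y i = x i - 1
                  & forall j : 'I_d, j != i -> y j = x j.

Definition sensitive_neighbors d (C : coloring d) (x : point d) :=
  [set y | neighbor x y /\ C y <> C x].

(* fset_set is the actual finite set only for finite sets, which is the case
   here by finite_sensitive_neighbors below. *)
Definition sensitivity_at d (C : coloring d) (x : point d) : nat :=
  #|` fset_set (sensitive_neighbors C x)|.

Definition shift d (x : point d) (p : 'I_d * bool) : point d :=
  [ffun j => if j == p.1 then x j + (-1) ^+ p.2 else x j].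

Lemma neighbor_shift d (x y : point d) :
  neighbor x y -> y \in [seq shift x p | p <- enum {: 'I_d * bool}].
Proof.
move=> [i yi yj]; apply/mapP.
have [b yib] : exists b : bool, y i = x i + (-1) ^+ b.
  by case: yi => ->; [exists false | exists true].
exists (i, b); first by rewrite mem_enum.
by apply/ffunP => j; rewrite ffunE /=; case: eqVneq => [->|/yj].
Qed.

Lemma finite_sensitive_neighbors d (C : coloring d) (x : point d) :
  finite_set (sensitive_neighbors C x).
Proof.
apply: (@sub_finite_set _ _
  [set` [seq shift x p | p <- enum {: 'I_d * bool}]]).
  by move=> y [/neighbor_shift].
by apply/finite_seqP; eexists; reflexivity.
Qed.

Lemma sensitivity_at_le d (C : coloring d) (x : point d) :
  (sensitivity_at C x <= d.*2)%N.
Proof.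
have -> : d.*2 = size [seq shift x p | p <- enum {: 'I_d * bool}].
  by rewrite size_map -cardE card_prod card_ord card_bool muln2.
apply: uniq_leq_size; first exact: fset_uniq.
move=> y; rewrite in_fset_set; last exact: finite_sensitive_neighbors.
by rewrite inE => -[/neighbor_shift].
Qed.

Lemma sensitivity_value_ex d (C : coloring d) :
  exists n, `[< exists x, sensitivity_at C x = n >].
Proof. by exists (sensitivity_at C 0); apply/asboolP; exists 0. Qed.

Lemma sensitivity_value_le d (C : coloring d) (n : nat) :
  `[< exists x, sensitivity_at C x = n >] -> (n <= d.*2)%N.
Proof. by move=> /asboolP[x <-]; exact: sensitivity_at_le. Qed.

Definition sensitivity d (C : coloring d) : nat :=
  ex_maxn (sensitivity_value_ex C) (@sensitivity_value_le d C).

Lemma sensitivityP d (C : coloring d) :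
  (exists x, sensitivity_at C x = sensitivity C) /\
  (forall x, (sensitivity_at C x <= sensitivity C)%N).
Proof.
rewrite /sensitivity; case: ex_maxnP => n /asboolP exn maxn; split => // x.
by apply: maxn; apply/asboolP; exists x.
Qed.

Lemma min_width_ex d (C : coloring d) :
  nontrivial C -> exists k, is_min_width C k.
Proof.
move=> [_ Cb].
have exk : exists k, `[< blue_within C k >].
  have /choice[f fP] : forall i : 'I_d,
      exists x, on_axis i x /\ C x = Blue.
    by move=> i; have [x ? ?] := Cb i; exists x.
  exists (\max_i `|f i i|)%N; apply/asboolP => i; exists (f i).
  by have [? ?] := fP i; split=> //; exact: (leq_bigmax i).
case: (ex_minnP exk) => k /asboolP bk mink; exists k; split=> // m bm.
by apply: mink; apply/asboolP.
Qed.

(* Main.v *)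
Require Import Defs.
From mathcomp Require Import all_boot all_order all_algebra.
From mathcomp Require Import reals sequences exp.
From mathcomp Require Import finmap boolp cardinality zify lra.

Import Order.TTheory GRing.Theory Num.Theory.
Local Open Scope ring_scope.

(** Call a direction [i] good at a red point [x] if [x + a_i u_i] is blue for
    some [a_i <= k], where [u_i] is a signed unit vector.  With sensitivity [s],
    the number [n] of good directions satisfies [n + 1 <= (27 s / 4) ^ k], by
    induction on [k]: add to [x] the vectors [u_j] for [j] in a random set [T]
    of good directions, each taken with probability [1 / (3 s)].  For all but
    [s] directions [i], the points [x + u_i] and [x + a_i u_i] are red and
    blue; moving both along [T \ i] meets at most [2 s] bad directions at every
    step, so both colors survive with probability at least
    [(1 - 1 / (3 s)) ^ (2 s) >= 4 / 9].  Hence some [T] leads to a red point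
    with at least [4 (n - s) / (27 s)] good directions, now with [a_i - 1] in
    place of [a_i].  Finally [27 / 4 <= e ^ 2]. *)

(** * Set families in which few one-element extensions fail *)

Section RobustFamilies.
Local Open Scope nat_scope.
Variables (I : finType) (A : {set I}).

(** Double counting of the pairs [T], [j] for which [j |: T] is again in the family: a member of
    size [t] has at least [#|A| - m - t] such [j], and a member of size [t.+1] arises from at most
    [t.+1] pairs. The binomials satisfy this recursion with equality. *)
Lemma card_robust_level (g : pred {set I}) (m t : nat) :
  g set0 ->
  (forall T : {set I}, T \subset A -> g T ->
     #|[set j in A :\: T | ~~ g (j |: T)]| <= m) ->
  'C(#|A| - m, t) <= #|[set T : {set I} | [&& T \subset A, #|T| == t & g T]]|.
Proof.
move=> g0 gS; elim: t => [|t IH].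
  by rewrite bin0 card_gt0; apply/set0Pn; exists set0; rewrite inE sub0set cards0 eqxx.
set N := fun t => [set T : {set I} | [&& T \subset A, #|T| == t & g T]].
rewrite -(@leq_pmul2l t.+1) // [_ * 'C(_, t.+1)]mulnC.
rewrite [X in X <= _]mulnC mul_bin_left.
apply: (@leq_trans (#|N t| * (#|A| - m - t))).
  by rewrite mulnC leq_mul2r IH orbT.
have up (T : {set I}) : T \in N t ->
    #|A| - m - t <= \sum_(j in A) ((j \notin T) && (j |: T \in N t.+1)).
  rewrite inE => /and3P[TA /eqP Tt gT].
  have := gS T TA gT; set B := [set j in _ | _] => Bm.
  have -> : \sum_(j in A) ((j \notin T) && (j |: T \in N t.+1))
          = #|(A :\: T) :\: B|.
    rewrite -sum1_card big_mkcond [RHS]big_mkcond /=; apply: eq_bigr => j _.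
    rewrite !inE; case: (boolP (j \in A)) => jA; last by rewrite !andbF.
    case: (boolP (j \in T)) => jT //=.
    by rewrite cardsU1 jT Tt subUset sub1set jA TA eqxx /= negbK; case: (g _).
  have := cardsD (A :\: T) B; have := cardsD A T.
  rewrite (setIidPr TA) Tt => -> ->.
  have : #|(A :\: T) :&: B| <= #|B| by rewrite subset_leq_card ?subsetIr.
  by lia.
apply: (@leq_trans (\sum_(T in N t)
    \sum_(j in A) ((j \notin T) && (j |: T \in N t.+1)))).
  by rewrite -sum_nat_const; apply: leq_sum => T; exact: up.
rewrite exchange_big /=.
have -> : t.+1 * #|N t.+1| = \sum_(j in A) \sum_(U in N t.+1) (j \in U).
  rewrite exchange_big /= mulnC -sum_nat_const; apply: eq_bigr => U.
  rewrite inE => /and3P[UA /eqP <- _].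
  rewrite -sum1_card big_mkcond [RHS]big_mkcond /=; apply: eq_bigr => j _.
  case: (boolP (j \in U)) => [/(subsetP UA) ->//|_]; by case: ifP.
apply: leq_sum => j jA.
rewrite [X in X <= _](_ : _ = #|[set T in N t | (j \notin T) && (j |: T \in N t.+1)]|); last first.
  rewrite -sum1_card big_mkcond [RHS]big_mkcond /=; apply: eq_bigr => T _.
  by rewrite !inE; case: ifP => //= _; case: ifP.
rewrite [X in _ <= X](_ : _ = #|[set U in N t.+1 | j \in U]|); last first.
  rewrite -sum1_card big_mkcond [RHS]big_mkcond /=; apply: eq_bigr => T _.
  by rewrite !inE; case: ifP => //= _; case: ifP.
rewrite -(@card_in_imset _ _ (fun T => j |: T)).
  apply/subset_leq_card/subsetP => _ /imsetP[T + ->].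
  by rewrite in_set => /and3P[_ _ TN]; rewrite in_set TN setU11.
move=> T1 T2; rewrite !in_set => /and3P[_ j1 _] /and3P[_ j2 _] e.
by rewrite -(setU1K j1) -(setU1K j2) e.
Qed.

Lemma sum_by_card (g : pred {set I}) (w : nat) :
  \sum_(T : {set I} | (T \subset A) && g T) w ^ (#|A| - #|T|) =
  \sum_(t < #|A|.+1)
    #|[set T : {set I} | [&& T \subset A, #|T| == t & g T]]| * w ^ (#|A| - t).
Proof.
rewrite (partition_big (fun T : {set I} => inord #|T| : 'I_#|A|.+1) xpredT) //=.
apply: eq_bigr => t _; rewrite -sum_nat_const.
apply: eq_big => [T|T /andP[/andP[TA _] /eqP <-]].
  rewrite inE -andbA; case: (boolP (T \subset A)) => //= TA.
  rewrite andbC; congr (_ && _); rewrite -val_eqE /= inordK //.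
  by rewrite ltnS subset_leq_card.
by rewrite inordK // ltnS subset_leq_card.
Qed.

(** The binomial theorem; this total mass normalizes the weights to probabilities. *)
Lemma sum_subset_weights (w : nat) :
  \sum_(T : {set I} | T \subset A) w ^ (#|A| - #|T|) = (w + 1) ^ #|A|.
Proof.
under eq_bigl do rewrite -[_ \subset _]andbT.
rewrite (sum_by_card xpredT) expnDn; apply: eq_bigr => t _.
rewrite exp1n muln1; congr (_ * _).
by rewrite -cards_draws; apply: eq_card => T; rewrite !inE andbT.
Qed.

(* Divided by [(w + 1) ^ #|A|]: a random subset of [A] that contains each
   element with probability [1 / (w + 1)] satisfies [g] with probability at
   least [(w / (w + 1)) ^ m]. *)
Lemma robust_weight_ge (g : pred {set I}) (m w : nat) :
  m <= #|A| -> g set0 ->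
  (forall T : {set I}, T \subset A -> g T ->
     #|[set j in A :\: T | ~~ g (j |: T)]| <= m) ->
  w ^ m * (w + 1) ^ (#|A| - m) <=
  \sum_(T : {set I} | (T \subset A) && g T) w ^ (#|A| - #|T|).
Proof.
move=> mA g0 gS; rewrite sum_by_card.
apply: (@leq_trans (\sum_(t < #|A|.+1) 'C(#|A| - m, t) * w ^ (#|A| - t))); last first.
  by apply: leq_sum => t _; rewrite leq_mul2r card_robust_level ?orbT.
(* The expansion of [(w + 1) ^ (#|A| - m)] is padded with zeros up to [t = #|A|], for a termwise
   comparison. *)
rewrite expnDn big_distrr /= (big_ord_widen #|A|.+1
  (fun t => w ^ m * ('C(#|A| - m, t) * (w ^ (#|A| - m - t) * 1 ^ t)))); last first.
  by rewrite ltnS leq_subr.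
rewrite big_mkcond /=; apply: leq_sum => t _; case: ifP => // tm.
rewrite exp1n muln1 mulnCA -expnD leq_mul2l leq_eqVlt.
by rewrite (_ : m + _ = #|A| - t) ?eqxx ?orbT //; lia.
Qed.

End RobustFamilies.

(** * Counting good directions under a sensitivity bound *)

Section LowSensitivity.
Local Open Scope nat_scope.

(** Bernoulli's inequality [(1 - 1/n)^m >= 1 - m/n], cleared of denominators. *)
Lemma expn_bernoulli (n m : nat) : m <= n -> n ^ m * (n - m) <= n * n.-1 ^ m.
Proof.
elim: m => [|m IH] mn; first by rewrite !expn0 subn0 mul1n muln1.
rewrite !expnS; have := IH (ltnW mn).
set a := n ^ m; set b := n.-1 ^ m => h.
have h1 : n.-1 * (a * (n - m)) <= n.-1 * (n * b) by rewrite leq_mul2l h orbT.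
have h2 : n * (n - m.+1) <= n.-1 * (n - m) by nia.
by nia.
Qed.

(** Bernoulli gives [(1 - 1/(3s))^s >= 2/3], which is then squared. *)
Lemma expn_ratio_ge (s : nat) : 0 < s ->
  4 * (3 * s) ^ (2 * s) <= 9 * (3 * s).-1 ^ (2 * s).
Proof.
move=> s0; have := @expn_bernoulli (3 * s) s.
rewrite !(mulnC 2 s) !expnM; set a := _ ^ s; set b := _ ^ s => h.
have {}h : 2 * a <= 3 * b by have := h ltac:(lia); nia.
by rewrite -(mulnn a) -(mulnn b); nia.
Qed.

Variables (V : nmodType) (I : finType) (u : I -> V) (f : V -> bool) (s : nat).
Hypothesis (s_gt0 : 0 < s)
  (f_sens : forall x : V, #|[set i | f (x + u i)%R != f x]| <= s).

(* A random [T] that contains each direction of [S] with probability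
   [1 / (3 * s)] keeps, for every [i] in [T] with [x + u i] red, the colors of
   both [x + u i] and [x + u i *+ a i] with probability at least [4 / 9]. *)
Lemma card_le_good_directions (x : V) (S : {set I}) (a : I -> nat) (D : nat) :
  2 * s < #|S| -> f x = false ->
  (forall i, i \in S -> f (x + u i *+ a i)%R) ->
  (forall T : {set I}, T \subset S ->
     #|[set i in T | ~~ f (x + \sum_(j in T) u j)%R &
                     f (x + \sum_(j in T) u j + u i *+ (a i).-1)%R]| <= D) ->
  4 * (#|S| - s) <= 27 * s * D.
Proof.
move=> Sbig fx fa hD.
pose w := (3 * s).-1; have w1 : w + 1 = 3 * s by rewrite /w; lia.
pose n := #|S|.
pose G (i : I) (T : {set I}) :=
  ~~ f (x + \sum_(j in T) u j)%R && f (x + \sum_(j in T) u j + u i *+ (a i).-1)%R.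
pose S' := [set i in S | ~~ f (x + u i)%R].
have S'n : n - s <= #|S'|.
  have := f_sens x; set B := [set i | _] => Bs.
  have : S :\: B \subset S'.
    by apply/subsetP => i; rewrite !inE fx => /andP[]; case: (f _) => // _ ->.
  move/subset_leq_card; rewrite cardsD.
  have : #|S :&: B| <= #|B| by rewrite subset_leq_card ?subsetIr.
  by rewrite /n; lia.
(* The weighted count of pairs [i], [T] is bounded from both sides. Each [T] contributes at most [D]
   directions. *)
have up : \sum_(T : {set I} | T \subset S) w ^ (n - #|T|) * #|[set i in T | G i T]|
    <= D * (3 * s) ^ n.
  rewrite -w1 -sum_subset_weights mulnC big_distrl /=; apply: leq_sum => T TS.
  by rewrite leq_mul2l hD ?orbT.
(* Each [i] in [S'] contributes through the sets [T] containing it: [T :\ i] ranges over the subsets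
   of [S :\ i], which has [n - 1] elements, and [2 * s] is the number of extensions that may
   fail. *)
have lo : (n - s) * (w ^ (2 * s) * (3 * s) ^ (n - 1 - 2 * s)) <=
    \sum_(T : {set I} | T \subset S) w ^ (n - #|T|) * #|[set i in T | G i T]|.
  have -> : \sum_(T : {set I} | T \subset S) w ^ (n - #|T|) * #|[set i in T | G i T]|
      = \sum_i \sum_(T : {set I} | T \subset S) w ^ (n - #|T|) * ((i \in T) && G i T).
    rewrite exchange_big /=; apply: eq_bigr => T _.
    rewrite -big_distrr /=; congr (_ * _).
    by rewrite -sum1_card big_mkcond /=; apply: eq_bigr => i _; rewrite inE; case: ifP.
  apply: (@leq_trans (#|S'| * (w ^ (2 * s) * (3 * s) ^ (n - 1 - 2 * s)))).
    by rewrite leq_mul2r S'n orbT.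
  rewrite -sum_nat_const big_mkcond /=; apply: leq_sum => i _; case: ifP => // iS'.
  have [iS fi] : i \in S /\ f (x + u i)%R = false.
    by move: iS'; rewrite inE => /andP[-> /negbTE].
  have a0 : 0 < a i.
    by have := fa i iS; case: (a i) => //; rewrite mulr0n addr0 fx.
  pose A := S :\ i.
  have cA : #|A| = n - 1 by rewrite /n (cardsD1 i S) iS; rewrite /A; lia.
  pose g (T : {set I}) :=
    ~~ f (x + u i + \sum_(j in T) u j)%R &&
       f (x + u i *+ a i + \sum_(j in T) u j)%R.
  have := @robust_weight_ge I A g (2 * s) w.
  rewrite cA w1 => /(_ ltac:(rewrite /n in cA *; lia)).
  have -> : g set0 by rewrite /g big_set0 !addr0 fi fa.
  move=> /(_ isT) H; apply: leq_trans (H _) _ => {H}.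
    move=> T TA /andP[g1 g2].
    (* An added [j] that breaks [g] is sensitive at one of two points, each with at most [s]
       sensitive directions. *)
    have sub : [set j in A :\: T | ~~ g (j |: T)] \subset
      [set j | f ((x + u i + \sum_(j in T) u j) + u j)%R != f (x + u i + \sum_(j in T) u j)%R] :|:
      [set j | f ((x + u i *+ a i + \sum_(j in T) u j) + u j)%R != f (x + u i *+ a i + \sum_(j in T) u j)%R].
      apply/subsetP => j; rewrite !inE g2 (negbTE g1) => /andP[/andP[jT _]].
      rewrite /g big_setU1 //= [(u j + _)%R]addrC !addrA.
      by case: (f _) => //=; case: (f _).
    apply: leq_trans (subset_leq_card sub) _.
    apply: leq_trans (leq_card_setU _ _) _.
    by rewrite mul2n -addnn leq_add ?f_sens.
  (* Membership of [i] in [i |: T] supplies one of the [a i] steps in direction [i], hence the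
     predecessor in [G]. *)
  have key (T : {set I}) : i \notin T -> G i (i |: T) = g T.
    move=> iT; rewrite /G /g big_setU1 //= !addrA; congr (_ && f _).
    rewrite -{2}(prednK a0) mulrSr -!addrA; congr (_ + _)%R.
    by rewrite addrA [LHS]addrC.
  rewrite [X in _ <= X](bigID (fun T : {set I} => i \in T)) /=; apply: leq_trans (leq_addr _ _).
  rewrite [X in _ <= X](reindex_onto (fun T => i |: T) (fun T => T :\ i)) /=; last first.
    by move=> T /andP[_ iT]; rewrite setD1K.
  rewrite [X in X <= _]big_mkcond [X in _ <= X]big_mkcond /=; apply: leq_sum => T _.
  case: ifP => // /andP[TA gT].
  have iT : i \notin T by apply/negP => /(subsetP TA); rewrite !inE eqxx.
  rewrite subUset sub1set iS (subset_trans TA (subD1set _ _)) setU11 setU1K // eqxx /=.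
  by rewrite key // gT muln1 cardsU1 iT subnDA.
have {lo up} := leq_trans lo up.
have -> : (3 * s) ^ n = (3 * s) ^ (n - 1 - 2 * s) * ((3 * s) ^ (2 * s) * (3 * s)).
  rewrite -expnSr -expnD; congr (_ ^ _); rewrite /n; lia.
have P0 : 0 < (3 * s) ^ (n - 1 - 2 * s) by rewrite expn_gt0; lia.
rewrite (mulnA (n - s)) (mulnC _ (_ ^ (n - 1 - 2 * s))) (mulnCA D) leq_pmul2l // => H.
(* The factor [27 * s] is [9 * (3 * s)]: the probability [1 / (3 * s)] that [i] is in [T] and the
   ratio [4 / 9] combine. *)
have := expn_ratio_ge _ s_gt0; rewrite -/w.
have : 0 < (3 * s) ^ (2 * s) by rewrite expn_gt0; lia.
move: H; set X := (3 * s) ^ _; set Y := w ^ _ => H X0 XY.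
rewrite -(leq_pmul2l X0) -/n.
have h1 : (n - s) * (4 * X) <= (n - s) * (9 * Y) by rewrite leq_mul2l XY orbT.
by lia.
Qed.

(** Counting [#|S|.+1] instead of [#|S|] absorbs the loss of [s] directions per induction step,
    since [4 * s + 4 <= 27 * s]. *)
Lemma card_blue_directions_le (k : nat) (x : V) (S : {set I}) (a : I -> nat) :
  f x = false -> (forall i, i \in S -> f (x + u i *+ a i)%R) ->
  (forall i, i \in S -> a i <= k) ->
  4 ^ k * #|S|.+1 <= (27 * s) ^ k.
Proof.
have pow k1 : 4 ^ k1 <= (27 * s) ^ k1.
  by elim: k1 => // m h; rewrite !expnS leq_mul //; lia.
elim: k x S a => [|k IH] x S a fx fa ak.
  suff -> : S = set0 by rewrite cards0.
  apply/setP => i; rewrite inE; apply/negP => iS.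
  by have := fa i iS; have := ak i iS; rewrite leqn0 => /eqP ->; rewrite mulr0n addr0 fx.
have [Ssmall|Sbig] := leqP #|S| (2 * s).
  (* A single factor suffices here: [4 * #|S|.+1 <= 8 * s + 4 <= 27 * s]. *)
  rewrite !expnS; apply: (@leq_trans (4 * #|S|.+1 * 4 ^ k)); first by lia.
  by rewrite leq_mul //; lia.
pose good (T : {set I}) :=
  [set i in T | ~~ f (x + \sum_(j in T) u j)%R &
                f (x + \sum_(j in T) u j + u i *+ (a i).-1)%R].
pose D := \max_(T : {set I} | T \subset S) #|good T|.
have Dk : 4 ^ k * D.+1 <= (27 * s) ^ k.
  have [T TS ->] : {T : {set I} | T \subset S & D = #|good T|}.
    apply: eq_bigmax_cond.
    by apply/card_gt0P; exists set0; rewrite unfold_in sub0set.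
  (* If the maximizing [T] leads to a blue point, then [good T] is empty and [D = 0]; otherwise the
     induction hypothesis applies at that red point. *)
  case fT: (f (x + \sum_(j in T) u j)%R).
    rewrite (_ : good T = set0) ?cards0 ?muln1 //.
    by apply/setP => i; rewrite !inE fT andbF.
  apply: (IH _ _ (fun i => (a i).-1) fT) => i; rewrite inE => /and3P[iT _ fi] //.
  by have := ak i (subsetP TS i iT); lia.
have := @card_le_good_directions x S a D Sbig fx fa.
move=> /(_ (fun T TS => leq_bigmax_cond _ TS)) H.
have {}H : 4 ^ k * (4 * #|S|.+1) <= 4 ^ k * (27 * s * D.+1).
  by rewrite leq_mul2l; apply/orP; right; lia.
rewrite !expnS; apply: leq_trans (leq_mul (leqnn (27 * s)) Dk).
by lia.
Qed.

End LowSensitivity.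

(** * Specialization to colorings of the lattice *)

Section Lattice.
Variables (d : nat) (C : coloring d).

Definition is_blue (x : point d) : bool := if C x is Blue then true else false.

(** One sign per axis is enough, because each axis is followed only towards one chosen blue
    point. *)
Definition signed_unit (b : 'I_d -> bool) (i : 'I_d) : point d :=
  [ffun j => if j == i then (-1) ^+ b i else 0].

Lemma add_signed_unit (b : 'I_d -> bool) (x : point d) (i : 'I_d) :
  x + signed_unit b i = shift x (i, b i).
Proof. by apply/ffunP => j; rewrite !ffunE /=; case: eqP => [->|]; rewrite ?addr0. Qed.

Lemma card_sensitive_directions_le (b : 'I_d -> bool) (x : point d) :
  (#|[set i | is_blue (x + signed_unit b i)%R != is_blue x]| <= sensitivity C)%N.
Proof.
apply: leq_trans ((sensitivityP C).2 x).
rewrite cardE -(size_map (fun i => shift x (i, b i))).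
apply: uniq_leq_size.
  rewrite map_inj_uniq ?enum_uniq // => i j /ffunP/(_ i).
  rewrite !ffunE /= eqxx; case: eqP => // _ /eqP.
  by rewrite -subr_eq0 addrC addKr signr_eq0.
move=> _ /mapP[i + ->]; rewrite mem_enum inE -add_signed_unit => hi.
rewrite in_fset_set; last exact: finite_sensitive_neighbors.
rewrite classical_sets.in_setE; split; last by move=> e; move: hi; rewrite /is_blue e eqxx.
exists i.
  by rewrite !ffunE eqxx; case: (b i); [right|left].
by move=> j /negbTE ji; rewrite !ffunE ji addr0.
Qed.

(** With zero sensitivity the red color of [x] would propagate along the whole ray. *)
Lemma sensitivity_gt0 (b : 'I_d -> bool) (x : point d) (i : 'I_d) (a : nat) :
  is_blue x = false -> is_blue (x + signed_unit b i *+ a) ->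
  (0 < sensitivity C)%N.
Proof.
move=> fx; rewrite lt0n; apply: contraTneq => s0.
elim: a => [|a IH]; first by rewrite mulr0n addr0 fx.
rewrite mulrSr addrA.
have := card_sensitive_directions_le b (x + signed_unit b i *+ a).
rewrite s0 leqn0 cards_eq0 => /eqP/setP/(_ i); rewrite !inE.
by move/negbT; rewrite negbK => /eqP ->.
Qed.

Lemma on_axisE (i : 'I_d) (x : point d) (b : 'I_d -> bool) :
  on_axis i x -> b i = (x i < 0) -> x = signed_unit b i *+ `|x i|%N.
Proof.
move=> ax bi; apply/ffunP => j; rewrite ffunMnE ffunE.
case: eqVneq => [->|ji]; last by rewrite mul0rn ax.
by rewrite bi -mulr_natr natz mulz_sign_abs.
Qed.

(** The counting bound at the origin with all [d] directions, where [b] orients each axis towards a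
    blue point at distance at most [k]. *)
Lemma min_width_dim_bound (k : nat) : (0 < d)%N -> nontrivial C ->
  blue_within C k ->
  (0 < sensitivity C)%N /\ (4 ^ k * d.+1 <= (27 * sensitivity C) ^ k)%N.
Proof.
move=> d0 [C0 _] /choice[y yP].
pose b i := (y i i < 0)%R.
have f0 : is_blue 0 = false by rewrite /is_blue C0.
have fa i : is_blue (0 + signed_unit b i *+ `|y i i|%N).
  have [ax yB _] := yP i; rewrite add0r -(on_axisE i (y i) b) //.
  by rewrite /is_blue yB.
have s0 := sensitivity_gt0 b 0 (Ordinal d0) _ f0 (fa _).
split=> //.
have := card_blue_directions_le (point d) _ (signed_unit b) is_blue _ s0
  (card_sensitive_directions_le b) k 0 [set: 'I_d] (fun i => `|y i i|%N) f0.
by rewrite cardsT card_ord; apply=> i _ //; have [] := yP i.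
Qed.

End Lattice.

(** * Passage to real numbers and [k]-th roots *)

Lemma expR1_sqr_ge (R : realType) : 27 / 4 <= expR 1 ^+ 2 :> R.
Proof.
(* The 24th power of [13/12] is about 6.83, above [27/4 = 6.75]. *)
have e : 1 + 12^-1 <= expR 12^-1 :> R by exact: expR_ge1Dx.
have -> : expR 1 ^+ 2 = expR 12^-1 ^+ 24 :> R.
  by rewrite -!expRM_natl; congr expR; lra.
apply: le_trans (lerXn2r 24 _ _ e); rewrite ?nnegrE ?expR_ge0 //; lra.
Qed.

Theorem theorem6 (R : realType) (d : nat) (hd : (0 < d)%N) (C : coloring d)
    (hC : nontrivial C) (k : nat) (hk : is_min_width C k) :
  (sensitivity C)%:R >= 1 / expR 1 ^+ 2 * d%:R `^ (1 / k%:R) :> R.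
Proof.
have [s0 bound] := min_width_dim_bound d C k hd hC hk.1.
set s := sensitivity C in s0 bound *.
(* For [k = 0] the bound would read [d + 1 <= 1]. Positivity lets the exponents [k] and [1 / k]
   cancel at the end. *)
have k0 : (0 < k)%N by case: (k) bound => //; rewrite !expn0 mul1n; lia.
have e0 : 0 < expR 1 ^+ 2 :> R by rewrite exprn_gt0 ?expR_gt0.
rewrite div1r mulrC ler_pdivrMr //.
have dle : d%:R <= (s%:R * expR 1 ^+ 2) ^+ k :> R.
  apply: (@le_trans _ _ ((27 / 4 * s%:R) ^+ k)).
    rewrite mulrAC expr_div_n ler_pdivlMr ?exprn_gt0 //.
    rewrite -natrM -!natrX -natrM ler_nat mulnC.
    by apply: leq_trans bound; rewrite leq_mul2l leqnSn orbT.
  apply: lerXn2r; rewrite ?nnegrE ?mulr_ge0 ?invr_ge0 ?expR_ge0 //.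
  by rewrite mulrC ler_wpM2l ?expR1_sqr_ge.
have B0 : 0 <= s%:R * expR 1 ^+ 2 :> R by rewrite mulr_ge0 // ltW.
move: dle B0; set B := _ * _ => dle B0.
apply: le_trans (ge0_ler_powR _ _ _ dle) _; rewrite ?nnegrE ?divr_ge0 ?exprn_ge0 //.
rewrite -powR_mulrn // -powRrM div1r mulfV ?pnatr_eq0 -?lt0n //.
by rewrite powRr1.
Qed.
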